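(* Let $G$ be a graph, $x$ a vertex of $G$ with $\deg x=k\ge 1$, and let $A=\{a_1,\dots,a_k\}$ be the set of neighbours of $x$. Then $$\psi(G)=\frac{(-1)^{k+1}}{2}\,\psi(\overline{G}_x)+\frac{(-1)^k}{4}\,\psi(\overline{G}_x^{a_1})+\frac14\,\psi(G_x^{a_1}),$$ where $\overline{G}_x$ is obtained from $G$ by deleting $x$ and inverting all edges within $A$ (i.e. complementing the induced subgraph on $A$: two distinct vertices of $A$ are adjacent in $\overline G_x$ iff they are not adjacent in $G$); $\overline{G}_x^{a_1}$ is obtained from $\overline{G}_x$ by applying the 2T transform to all pairs $(a_1,a_i)$, $i=2,\dots,k$, and then deleting $a_1$; and $G_x^{a_1}$ is obtained from $G$ by deleting $x$, applying the 2T transform to all pairs $(a_1,a_i)$, $i=2,\dots,k$, and then deleting $a_1$.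
   Context: All graphs are finite and simple. A framed graph is a graph together with a function (framing) from its vertex set to $\mathbb{Z}/2\mathbb{Z}$. The adjacency matrix over $\mathbb{Z}/2\mathbb{Z}$ of a framed graph has the usual off-diagonal adjacency entries, and its diagonal entries are the framings of the corresponding vertices. $\eta$ denotes the corank (dimension of the kernel) of this matrix over $\mathbb{Z}/2\mathbb{Z}$; it is $0$ for the empty graph. For a (non-framed) graph $G$ with vertex set $V$, $$\psi(G)=2^{-|V|}\sum_{V'\subseteq V}(-1)^{|V'|}\,3^{\eta(G_{V'})},$$ where $G_{V'}$ is the framed graph obtained from $G$ by assigning framing $1$ to the vertices in $V'$ and framing $0$ to the vertices in $V\setminus V'$. The 2T transform of a (non-framed) graph for an ordered pair $(a,b)$ of distinct vertices switches the adjacency of $b$ with every vertex $v\neq a,b$ that is adjacent to $a$ (so the set of neighbours of $b$ outside $\{a,b\}$ is replaced by its symmetric difference with the set of neighbours of $a$ outside $\{a,b\}$), leaving everything else, including the presence or absence of the edge $ab$, unchanged. *)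

(* Defs.v *)
From mathcomp Require Import all_boot all_order all_algebra.

Set Implicit Arguments.
Unset Strict Implicit.
Unset Printing Implicit Defensive.

Import Order.TTheory GRing.Theory Num.Theory.
Local Open Scope ring_scope.

(* The vertex set is a subset of an ambient finite type, so that deleting a
   vertex does not change the type of the remaining vertices. *)
Record graph (T : finType) := Graph {
  vset : {set T};
  adj : rel T;
  adj_sym : symmetric adj;
  adj_irrefl : irreflexive adj;
  adj_vset : forall u v, adj u v -> u \in vset }.

(* Only the values of the framing on [vset] matter. *)
Record framed_graph (T : finType) := FramedGraph {
  fgraph_of : graph T;
  framing : T -> 'F_2 }.

Section Graphs.
Variable T : finType.
Implicit Types (G : graph T) (F : framed_graph T) (A : {set T}).
Implicit Types (u v x a b : T).

Definition nbrs G x : {set T} := [set v | adj G x v].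

Definition deg G x : nat := #|nbrs G x|.

Definition adj_mx F : 'M['F_2]_#|vset (fgraph_of F)| :=
  \matrix_(i, j) if i == j then framing F (enum_val i)
                 else (adj (fgraph_of F) (enum_val i) (enum_val j))%:R.

(* [kermx] is the kernel of the action on row vectors; [adj_mx] is symmetric,
   so this is also the kernel on column vectors. *)
Definition eta F : nat := \rank (kermx (adj_mx F)).

Definition frame G A : framed_graph T :=
  FramedGraph G (fun v => (v \in A)%:R).

Definition psi G : rat :=
  2 ^- #|vset G| *
  \sum_(A in powerset (vset G)) (-1) ^+ #|A| * 3 ^+ eta (frame G A).

Definition del_adj G x : rel T :=
  fun u v => [&& u != x, v != x & adj G u v].

Fact del_adj_sym G x : symmetric (del_adj G x).
Proof. by move=> u v; rewrite /del_adj adj_sym andbCA. Qed.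

Fact del_adj_irrefl G x : irreflexive (del_adj G x).
Proof. by move=> u; rewrite /del_adj adj_irrefl !andbF. Qed.

Fact del_adj_vset G x u v : del_adj G x u v -> u \in vset G :\ x.
Proof. by case/and3P=> ux _ /adj_vset uG; rewrite !inE ux. Qed.

Definition del G x : graph T :=
  Graph (@del_adj_sym G x) (@del_adj_irrefl G x) (@del_adj_vset G x).

(* The tests [_ \in vset G] here and in [twoT_adj] only keep the relation
   supported on [vset G]; they are redundant for A \subset vset G, resp. for
   b \in vset G. *)
Definition invert_adj G A : rel T :=
  fun u v => [&& u \in vset G, v \in vset G &
    adj G u v (+) [&& u != v, u \in A & v \in A]].

Fact invert_adj_sym G A : symmetric (invert_adj G A).
Proof.
move=> u v; rewrite /invert_adj adj_sym eq_sym andbCA.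
by rewrite [(u \in A) && _]andbC.
Qed.

Fact invert_adj_irrefl G A : irreflexive (invert_adj G A).
Proof. by move=> u; rewrite /invert_adj adj_irrefl eqxx !andbF. Qed.

Fact invert_adj_vset G A u v : invert_adj G A u v -> u \in vset G.
Proof. by case/and3P. Qed.

Definition invert G A : graph T :=
  Graph (@invert_adj_sym G A) (@invert_adj_irrefl G A)
        (@invert_adj_vset G A).

Definition twoT_switch G a b : rel T :=
  fun u v => [&& u == b, v != a, v != b & adj G a v].

(* [twoT_switch] is directed from [b]; both directions are switched. *)
Definition twoT_adj G a b : rel T :=
  fun u v => [&& u \in vset G, v \in vset G &
    adj G u v (+) (twoT_switch G a b u v || twoT_switch G a b v u)].

Fact twoT_adj_sym G a b : symmetric (twoT_adj G a b).
Proof. by move=> u v; rewrite /twoT_adj adj_sym andbCA [_ || _]orbC. Qed.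

Fact twoT_adj_irrefl G a b : irreflexive (twoT_adj G a b).
Proof.
move=> u; rewrite /twoT_adj /twoT_switch adj_irrefl orbb.
by case: (u == b); rewrite ?andbF.
Qed.

Fact twoT_adj_vset G a b u v : twoT_adj G a b u v -> u \in vset G.
Proof. by case/and3P. Qed.

Definition twoT G a b : graph T :=
  Graph (@twoT_adj_sym G a b) (@twoT_adj_irrefl G a b)
        (@twoT_adj_vset G a b).

Definition twoT_seq G a (s : seq T) : graph T :=
  foldl (fun H b => twoT H a b) G s.

End Graphs.

(* Main.v *)
(* Split the sum defining psi G by the framing of x, and, when x has framing 0,
   by the framing of a1.  Taking a Schur complement of the adjacency matrix over
   F_2 preserves the corank.  If x has framing 1, pivoting on it adds 1 to all
   entries in A x A: the edges within A are inverted and the framings of A are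
   flipped.  If x has framing 0, pivoting on the 2 x 2 block of {x, a1}, whose
   determinant is 1, yields the 2T transforms of G - x when a1 has framing 0, and
   those of the inverted graph, with the framings of A minus a1 flipped, when a1
   has framing 1.  Flipping framings on B permutes the terms of psi and
   multiplies their signs by (-1)^|B|. *)

Require Import Defs.
From mathcomp Require Import all_boot all_order all_algebra.
From mathcomp Require Import ring.

Set Implicit Arguments.
Unset Strict Implicit.
Unset Printing Implicit Defensive.

Import Order.TTheory GRing.Theory Num.Theory.
Local Open Scope ring_scope.

(** * Rank-one updates and coranks under pivoting *)

(** Row [r] of the sum is [v], so its row space is that of [B] plus the line of [v]. The two meet
    trivially: vectors in the row space of [B] vanish at [c], where [v] is 1. *)
Lemma mxrank_add_outer (F : fieldType) (m n : nat) (B : 'M[F]_(m, n))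
    (u : 'cV_m) (v : 'rV_n) (r : 'I_m) (c : 'I_n) :
  u r 0 = 1 -> v 0 c = 1 -> row r B = 0 -> col c B = 0 ->
  \rank (B + u *m v)%R = (\rank B).+1.
Proof.
move=> ur vc Br Bc.
have row_r : row r (B + u *m v) = v.
  rewrite raddfD /= Br add0r row_mul; apply/rowP=> j.
  by rewrite mxE big_ord1 mxE ur mul1r.
have v_sub : (v <= (B + u *m v)%R)%MS by rewrite -[X in (X <= _)%MS]row_r row_sub.
have sumE : (B + v == (B + u *m v)%R)%MS.
  apply/andP; split.
    rewrite addsmx_sub v_sub andbT -{1}(addrK (u *m v) B).
    by rewrite addmx_sub // eqmx_opp mulmx_sub.
  by rewrite addmx_sub_adds // submxMl.
have v_rank : \rank v = 1%N.
  apply/eqP; rewrite rank_rV; case: (eqVneq v 0) vc => [->|//].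
  by rewrite mxE => /eqP; rewrite eq_sym oner_eq0.
rewrite -(eqmx_rank sumE) mxrank_disjoint_sum ?v_rank ?addn1 //.
apply/eqP/rowV0P=> w; rewrite sub_capmx => /andP[/submxP[d ->]].
case/sub_rVP=> e dB.
have : (d *m B) 0 c = e by rewrite dB mxE vc mulr1.
rewrite mxE big1 => [e0|i _]; first by rewrite dB -e0 scale0r.
by have /colP/(_ i) := Bc; rewrite !mxE => ->; rewrite mulr0.
Qed.

Section Corank.
Variables (F : fieldType) (T : finType).
Implicit Types (S R C : {set T}) (m : T -> T -> F).

(* Zero-padding to all of [T] keeps one matrix size when rows and columns are
   deleted. *)
Definition padded_mx R C m : 'M[F]_#|T| :=
  \matrix_(i, j) if (enum_val i \in R) && (enum_val j \in C)
                 then m (enum_val i) (enum_val j) else 0.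

(** Padding does not change the rank, so subtracting from [#|R|] rather than [#|T|] gives the
    dimension of the left kernel of the block itself. *)
Definition corank R C m : nat := (#|R| - \rank (padded_mx R C m))%N.

Lemma eq_corank R C m m' :
  {in R & C, m =2 m'} -> corank R C m = corank R C m'.
Proof.
move=> mm'; congr (_ - \rank _)%N; apply/matrixP=> i j; rewrite !mxE.
by case: andP => // -[iR jC]; apply: mm'.
Qed.

(** The matrix is its padded Schur complement plus the product of column [c] and row [r], so the
    rank and the number of rows both drop by one. Separate row and column sets allow pivots off the
    diagonal. *)
Lemma corank_pivot R C m r c :
  r \in R -> c \in C -> m r c = 1 ->
  corank R C m = corank (R :\ r) (C :\ c) (fun i j => m i j - m i c * m r j).
Proof.
move=> rR cC mrc; rewrite /corank (cardsD1 r R) rR add1n.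
set B := padded_mx (R :\ r) _ _.
pose u : 'cV[F]_#|T| :=
  \col_i if enum_val i \in R then m (enum_val i) c else 0.
pose v : 'rV[F]_#|T| :=
  \row_j if enum_val j \in C then m r (enum_val j) else 0.
have -> : padded_mx R C m = B + u *m v.
  apply/matrixP=> i j; rewrite !mxE big_ord1 !mxE !inE.
  case: (enum_val i \in R); case: (enum_val j \in C);
    rewrite ?andbF ?mulr0 ?mul0r ?addr0 // !andbT.
  have [->|] := eqVneq (enum_val i) r; first by rewrite mrc mul1r add0r.
  have [->|] := eqVneq (enum_val j) c; first by rewrite mrc mulr1 add0r.
  by rewrite subrK.
rewrite (@mxrank_add_outer _ _ _ _ _ _ (enum_rank r) (enum_rank c)) ?subSS //.
- by rewrite mxE enum_rankK rR.
- by rewrite mxE enum_rankK cC.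
- by apply/rowP=> j; rewrite !mxE enum_rankK !inE eqxx.
- by apply/colP=> i; rewrite !mxE enum_rankK !inE eqxx andbF.
Qed.

Lemma corank_kermx S m :
  \rank (kermx (\matrix_(i < #|S|, j < #|S|) m (enum_val i) (enum_val j)))
    = corank S S m.
Proof.
set B := matrix_of_fun _ _.
rewrite mxrank_ker /corank; congr (_ - _)%N.
pose P : 'M[F]_(#|S|, #|T|) := \matrix_(i, j) (enum_val i == enum_val j)%:R.
have PE i j : P i j = (enum_rank (enum_val i) == j)%:R.
  by rewrite mxE -(inj_eq enum_rank_inj) enum_valK.
have PES i j (jS : enum_val j \in S) :
    P i j = (i == enum_rank_in jS (enum_val j))%:R.
  by rewrite mxE -(inj_eq enum_val_inj) enum_rankK_in.
have mulP_l n (M : 'M[F]_(#|T|, n)) i j :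
    (P *m M) i j = M (enum_rank (enum_val i)) j.
  rewrite mxE (bigD1 (enum_rank (enum_val i))) //= PE eqxx mul1r big1 ?addr0 //.
  by move=> l ne; rewrite PE eq_sym (negPf ne) mul0r.
have mulPT_in n (M : 'M[F]_(#|S|, n)) i j (iS : enum_val i \in S) :
    (P^T *m M) i j = M (enum_rank_in iS (enum_val i)) j.
  rewrite mxE (bigD1 (enum_rank_in iS (enum_val i))) //= mxE PES eqxx mul1r.
  by rewrite big1 ?addr0 // => l ne; rewrite mxE PES (negPf ne) mul0r.
have mulPT_notin n (M : 'M[F]_(#|S|, n)) i j :
    enum_val i \notin S -> (P^T *m M) i j = 0.
  move=> iS; rewrite mxE; apply: big1 => l _; rewrite !mxE.
  case: eqP => [e|]; last by rewrite mul0r.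
  by rewrite -e enum_valP in iS.
(* Each matrix is a two-sided product of the other with [P] or its transpose, so each rank bounds
   the other. Transposing in between turns column selection into row selection. *)
have BE : B = P *m (P *m (padded_mx S S m)^T)^T.
  apply/matrixP=> i j.
  by rewrite [LHS]mxE mulP_l mxE mulP_l !mxE !enum_rankK !enum_valP.
have padE : padded_mx S S m = P^T *m (P^T *m B^T)^T.
  apply/matrixP=> i j; rewrite [LHS]mxE.
  have [iS|iS] := boolP (enum_val i \in S); last by rewrite mulPT_notin.
  rewrite mulPT_in mxE; have [jS|jS] := boolP (enum_val j \in S).
    by rewrite mulPT_in !mxE !enum_rankK_in.
  by rewrite mulPT_notin.
apply/eqP; rewrite eqn_leq; apply/andP; split.
  by rewrite BE (leq_trans (mxrankM_maxr _ _)) // mxrank_tr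
    (leq_trans (mxrankM_maxr _ _)) // mxrank_tr.
by rewrite padE (leq_trans (mxrankM_maxr _ _)) // mxrank_tr
  (leq_trans (mxrankM_maxr _ _)) // mxrank_tr.
Qed.

End Corank.

(** * Signs and sums over subsets under symmetric difference *)

Section SymmetricDifference.
Variable T : finType.
Implicit Types (A B V : {set T}).

Definition symdiff A B : {set T} := [set v | (v \in A) (+) (v \in B)].

Lemma symdiffK B : involutive (symdiff^~ B).
Proof. by move=> A; apply/setP=> v; rewrite !inE addbK. Qed.

(** The parity of a cardinality is the exclusive or of all membership bits, hence additive under
    symmetric difference. *)
Lemma signr_symdiff (R : pzRingType) A B :
  (-1) ^+ #|symdiff A B| = (-1) ^+ #|A| * (-1) ^+ #|B| :> R.
Proof.
have cardE (D : {set T}) : odd #|D| = \big[addb/false]_v (v \in D).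
  rewrite -sum1_card big_mkcond /=.
  rewrite (big_morph odd oddD (erefl _)).
  by apply: eq_bigr => v _; case: (v \in D).
rewrite -signr_odd -[in RHS]signr_odd -(signr_odd _ #|B|) -signr_addb.
rewrite !cardE -big_split /=; congr (_ ^+ nat_of_bool _).
by apply: eq_bigr => v _; rewrite inE.
Qed.

Lemma big_powersetD1 (M : nmodType) V x (f : {set T} -> M) : x \in V ->
  \sum_(A in powerset V) f A =
  \sum_(A in powerset (V :\ x)) f A
  + \sum_(A in powerset (V :\ x)) f (x |: A).
Proof.
move=> xV; rewrite (bigID (fun A : {set T} => x \in A)) /= addrC; congr (_ + _).
  by apply: eq_bigl => A; rewrite !powersetE subsetD1.
rewrite (reindex_onto (fun A => x |: A) (fun A => A :\ x)) /=; last first.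
  by move=> A /andP[_ xA]; rewrite setD1K.
apply: eq_bigl => A; rewrite !powersetE subUset sub1set xV setU11 andbT /=.
rewrite subsetD1; case: (boolP (x \in A)) => xA; last by rewrite setU1K ?eqxx.
rewrite !andbF; apply/negP=> /andP[_ /eqP e].
by rewrite -e !inE eqxx in xA.
Qed.

Lemma big_powerset_symdiff (M : nmodType) V B (f : {set T} -> M) : B \subset V ->
  \sum_(A in powerset V) f A = \sum_(A in powerset V) f (symdiff A B).
Proof.
move=> BV; rewrite (reindex_inj (inv_inj (symdiffK B))) /=.
apply: eq_bigl => A; rewrite !powersetE.
have sub (D : {set T}) : D \subset V -> symdiff D B \subset V.
  move=> DV; apply/subsetP=> v; rewrite inE.
  by case vB: (v \in B); [move/(subsetP BV): vB | rewrite addbF => /(subsetP DV)].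
by apply/idP/idP=> [/sub|/sub//]; rewrite symdiffK.
Qed.

End SymmetricDifference.

(** * Framed adjacency entries and iterated 2T transforms *)

Section GraphCorank.
Variable T : finType.
Implicit Types (G H : graph T) (A S : {set T}) (e : rel T).

Definition framed_entry e A (u v : T) : 'F_2 :=
  if u == v then (u \in A)%:R else (e u v)%:R.

Lemma eta_frame G A :
  eta (frame G A) = corank (vset G) (vset G) (framed_entry (adj G) A).
Proof.
rewrite -corank_kermx /eta; congr (\rank (kermx _)).
by apply/matrixP=> i j; rewrite !mxE /framed_entry (inj_eq enum_val_inj).
Qed.

Lemma vset_twoT_seq G b (s : seq T) : vset (twoT_seq G b s) = vset G.
Proof. by elim: s G => //= c s IHs G; rewrite IHs. Qed.

Lemma adj_vset2 G u v : adj G u v -> (u \in vset G) && (v \in vset G).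
Proof. by move=> uv; rewrite (adj_vset uv) (@adj_vset _ G v u) // adj_sym. Qed.

(** No transform at a pair [(b, c)] alters the neighbours of [b], so every switch is governed by the
    original row of [b]; uniqueness ensures each vertex of [s] is switched once. *)
Lemma adj_twoT_seq G b (s : seq T) u v :
  uniq (b :: s) -> u \in vset G -> v \in vset G -> u != b -> v != b -> u != v ->
  adj (twoT_seq G b s) u v =
  adj G u v (+) ((u \in s) && adj G b v) (+) ((v \in s) && adj G b u).
Proof.
move=> us uG vG ub vb uv; elim: s G us uG vG => [|c s IHs] G /=.
  by rewrite !addbF.
rewrite !inE negb_or => /and3P[/andP[bc bs] cs us] uG vG.
have adjb w : adj (twoT G b c) b w = adj G b w.
  rewrite /= /twoT_adj /twoT_switch (negPf bc) eqxx !andbF addbF.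
  case bw: (adj G b w); last by rewrite !andbF.
  by case/andP: (adj_vset2 bw) => -> ->.
rewrite IHs ?adjb //; last by rewrite /= bs.
rewrite [adj (twoT _ _ _) u v]/= /twoT_adj /twoT_switch uG vG ub vb /=.
have [uc|uc] := eqVneq u c; have [vc|vc] := eqVneq v c.
- by rewrite uc vc eqxx in uv.
- rewrite uc (negPf cs) /= orbF; subst u; do 3!case: (adj _ _ _) => //=;
    by case: (_ \in s).
- rewrite vc (negPf cs) /=; subst v; do 3!case: (adj _ _ _) => //=;
    by case: (_ \in s).
- by rewrite addbF.
Qed.

End GraphCorank.

Lemma oppr_F2 (f : 'F_2) : - f = f.
Proof. by rewrite oppr_pchar2 // pchar_Fp. Qed.

(** * Pivoting at [x] and at the pair [x], [b] *)

Section Pivots.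
Variables (T : finType) (G : graph T) (x : T).
Hypothesis xG : x \in vset G.
Let N := nbrs G x.

Lemma eta_pivot_framed (A : {set T}) : x \notin A ->
  eta (frame G (x |: A)) = eta (frame (invert (del G x) N) (symdiff A N)).
Proof.
move=> xA; rewrite !eta_frame (corank_pivot xG xG); last first.
  by rewrite /framed_entry eqxx setU11.
apply: eq_corank => u v; rewrite !inE => /andP[ux uG] /andP[vx vG].
rewrite /framed_entry /= /invert_adj /= /del_adj !inE.
rewrite (negPf ux) (negPf vx) (eq_sym x) (negPf vx) uG vG /= (adj_sym G u x).
have [->|uv] := eqVneq u v.
  by do 2!case: (_ (_ : T)); apply/eqP.
by case: (adj G u v); case: (adj G x u); case: (adj G x v); apply/eqP.
Qed.

Variables (b : T) (s : seq T).
Hypothesis us : uniq (b :: s).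
Hypothesis NE : N = [set:: b :: s].

Lemma nbrs_mem v : adj G x v = (v \in b :: s).
Proof. by rewrite -[LHS]in_set -/(nbrs G x) -/N NE inE. Qed.

Let xb : x != b.
Proof.
by apply/eqP=> e; have := nbrs_mem b; rewrite inE eqxx -e adj_irrefl.
Qed.
Let bG : b \in vset G.
Proof.
have := nbrs_mem b; rewrite inE eqxx => /adj_vset2.
by case/andP.
Qed.

(* Two successive Schur complements, at the entries (x, b) and (b, x): the
   diagonal entry at [x] is 0, so [x] alone is not a pivot. *)
Lemma eta_pivot_pair (A : {set T}) : x \notin A ->
  eta (frame G A) =
  corank (vset G :\ x :\ b) (vset G :\ x :\ b)
    (fun u v => framed_entry (adj G) A u v + (u \in s)%:R * (adj G b v)%:R
      + (adj G b u)%:R * (v \in s)%:R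
      + (b \in A)%:R * (u \in s)%:R * (v \in s)%:R).
Proof.
move=> xA; have adjxb : adj G x b by rewrite nbrs_mem mem_head.
rewrite eta_frame (corank_pivot xG bG); last first.
  by rewrite /framed_entry (negPf xb) adjxb.
rewrite (@corank_pivot _ _ _ _ _ b x); first last.
(* The second pivot is still 1: its correction carries the diagonal entry at [x], which is 0. *)
- rewrite /framed_entry eqxx (negPf xA) (eq_sym b) (negPf xb) adj_sym adjxb.
  by rewrite eqxx mulr0 subr0.
- by rewrite !inE xb.
- by rewrite !inE eq_sym xb.
rewrite setDDl setUC -setDDl.
apply: eq_corank => u v; rewrite !inE => /and3P[ux ub uG] /and3P[vx vb vG].
rewrite /framed_entry !eqxx (negPf ub) (negPf ux) !(eq_sym _ v) (negPf vb).
rewrite (negPf vx) (negPf xA) (adj_sym G u b) (adj_sym G u x) !nbrs_mem.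
rewrite !inE (negPf ub) (negPf vb) /=.
by rewrite !oppr_F2; ring.
Qed.

Lemma eta_pivot_unframed (A : {set T}) : x \notin A -> b \notin A ->
  eta (frame G A) = eta (frame (del (twoT_seq (del G x) b s) b) A).
Proof.
move=> xA bA; rewrite eta_pivot_pair // eta_frame /= vset_twoT_seq.
apply: eq_corank => u v uV vV.
have:= uV; have:= vV; rewrite !inE => /and3P[vb vx vG] /and3P[ub ux uG].
rewrite /framed_entry /= /del_adj ub vb /=.
have [->|uv] := eqVneq u v.
  (* On the diagonal the two cross terms coincide and cancel in characteristic 2, so framings are
     unchanged. *)
  rewrite (negPf bA) !mul0r addr0 mulrC -addrA -{2}(oppr_F2 (_ * _)) subrr.
  by rewrite addr0.
rewrite adj_twoT_seq ?inE ?ux ?vx //= /del_adj ux vx (eq_sym b) xb /=.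
rewrite (negPf bA).
by case: (adj G u v); case: (u \in s); case: (v \in s); case: (adj G b u);
  case: (adj G b v); apply/eqP.
Qed.

(** Framing 1 at [b] adds 1 on all of [s] times [s]. On the graph side, inversion also complements
    the edges from [b] to [s]; for [u] and [v] both in [s] these two extra ones cancel in the 2T
    switches, leaving the 1 from inverting [uv]. *)
Lemma eta_pivot_framed_pair (A : {set T}) : x \notin A -> b \notin A ->
  eta (frame G (b |: A)) =
  eta (frame (del (twoT_seq (invert (del G x) N) b s) b)
         (symdiff A [set:: s])).
Proof.
move=> xA bA.
rewrite eta_pivot_pair ?inE ?negb_or ?xb // eta_frame /= vset_twoT_seq.
apply: eq_corank => u v uV vV.
have:= uV; have:= vV; rewrite !inE => /and3P[vb vx vG] /and3P[ub ux uG].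
rewrite /framed_entry /= /del_adj ub vb /= !inE eqxx (negPf ub) /=.
have [->|uv] := eqVneq u v.
  by case: (v \in A); case: (v \in s); case: (adj G b v); apply/eqP.
rewrite adj_twoT_seq ?inE ?ux ?vx //= /invert_adj /= /del_adj.
rewrite !inE !nbrs_mem !inE ux vx uG vG bG (eq_sym b x) xb eqxx uv.
rewrite !(eq_sym b) ub vb (negPf ub) (negPf vb) /=.
by case: (adj G u v); case: (u \in s); case: (v \in s); case: (adj G b u);
  case: (adj G b v); apply/eqP.
Qed.

End Pivots.

(** * Assembling the three partial sums *)

Theorem theorem3p6 (T : finType) (G : graph T) (x : T) (k : nat)
    (a1 : T) (a : seq T)
    (hx : x \in vset G) (hdeg : deg G x = k) (hk : (1 <= k)%N)
    (huniq : uniq (a1 :: a)) (hA : nbrs G x = [set:: a1 :: a]) :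
  let Gbar_x := invert (del G x) (nbrs G x) in
  let Gbar_x_a1 := del (twoT_seq Gbar_x a1 a) a1 in
  let G_x_a1 := del (twoT_seq (del G x) a1 a) a1 in
  psi G = (-1) ^+ k.+1 / 2 * psi Gbar_x
          + (-1) ^+ k / 4 * psi Gbar_x_a1
          + 1 / 4 * psi G_x_a1.
Proof.
move=> Gb Gba Ga.
set V := vset G; set N := nbrs G x.
have xN : x \notin N by rewrite inE adj_irrefl.
have NV : N \subset V :\ x.
  apply/subsetP=> v vN; rewrite !inE.
  have [vx|_] := eqVneq v x; first by rewrite -vx vN in xN.
  by move: vN; rewrite inE => /adj_vset2 /andP[].
have a1N : a1 \in N by rewrite /N hA inE mem_head.
have a1V : a1 \in V :\ x := subsetP NV _ a1N.
have aE : [set:: a] = N :\ a1.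
  apply/setP=> v; rewrite /N hA !inE; case: eqP => //= ->.
  by apply/negbTE; case/andP: huniq.
have aV : [set:: a] \subset V :\ x :\ a1 by rewrite aE setSD.
have cardN : #|N| = k by [].
have carda : #|[set:: a]| = k.-1 by rewrite -cardN (cardsD1 a1 N) a1N aE.
have cardV : #|V| = #|V :\ x|.+1 by rewrite (cardsD1 x) hx.
have cardVx : #|V :\ x| = #|V :\ x :\ a1|.+1 by rewrite (cardsD1 a1) a1V.
pose f (A : {set T}) : rat := (-1) ^+ #|A| * 3 ^+ eta (frame G A).
(* Flipping the [k] framings on [N] gives the sign [(-1) ^+ k], and [x] itself one more factor
   -1. *)
have sumGb : \sum_(A in powerset (V :\ x)) f (x |: A) =
    (-1) ^+ k.+1 * \sum_(A in powerset (V :\ x))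
      (-1) ^+ #|A| * 3 ^+ eta (frame Gb A).
  rewrite [in RHS](big_powerset_symdiff _ NV) mulr_sumr.
  apply: eq_bigr => A; rewrite powersetE subsetD1 => /andP[_ xA].
  rewrite /f (eta_pivot_framed hx xA) mulrA; congr (_ * _).
  rewrite cardsU1 xA signr_symdiff cardN !exprS mulrCA mulrA mulrA.
  by rewrite -mulrA -expr2 sqrr_sign mulr1 mulrC.
(* Here only [k.-1] framings are flipped; the framed vertex [a1] supplies the remaining factor
   -1. *)
have sumGba : \sum_(A in powerset (V :\ x :\ a1)) f (a1 |: A) =
    (-1) ^+ k * \sum_(A in powerset (V :\ x :\ a1))
      (-1) ^+ #|A| * 3 ^+ eta (frame Gba A).
  rewrite [in RHS](big_powerset_symdiff _ aV) mulr_sumr.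
  apply: eq_bigr => A; rewrite powersetE !subsetD1 => /andP[/andP[_ xA] aA].
  rewrite /f (eta_pivot_framed_pair hx huniq hA xA aA) mulrA; congr (_ * _).
  rewrite cardsU1 aA signr_symdiff carda -{1}(prednK hk) !exprS.
  have := sqrr_sign rat k.-1; set e := (-1) ^+ k.-1; set d := (-1) ^+ #|A|.
  by move=> e2; rewrite -[LHS]mulr1 -e2; ring.
have sumGa : \sum_(A in powerset (V :\ x :\ a1)) f A =
    \sum_(A in powerset (V :\ x :\ a1))
      (-1) ^+ #|A| * 3 ^+ eta (frame Ga A).
  apply: eq_bigr => A; rewrite powersetE !subsetD1 => /andP[/andP[_ xA] aA].
  by rewrite /f (eta_pivot_unframed hx huniq hA xA aA).
have vGba : vset Gba = V :\ x :\ a1 by rewrite /= vset_twoT_seq.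
have vGa : vset Ga = V :\ x :\ a1 by rewrite /= vset_twoT_seq.
have vGb : vset Gb = V :\ x by [].
(* Abstracting the graphs and [f] keeps rewriting from comparing distinct
   [eta] terms by unfolding them. *)
clearbody Gb Gba Ga.
have psiG : psi G = 2 ^- #|V| * \sum_(A in powerset V) f A by [].
clearbody f.
rewrite psiG (big_powersetD1 f hx) (big_powersetD1 f a1V) sumGb sumGba sumGa.
rewrite /psi vGb vGba vGa.
(* The one or two vertices deleted from [G] account for the factors 1/2 and 1/4. *)
rewrite cardV cardVx !exprS.
move: (\sum_(A in _) _) => s1; move: (\sum_(A in _) _) => s2.
move: (\sum_(A in _) _) => s3.
move: #|V :\ x :\ a1| => n.
have n0 : 2 ^+ n != 0 :> rat by rewrite expf_neq0.
move: ((-1) ^+ k) (2 ^+ n) n0 => e p n0.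
by field.
Qed.
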